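(* Let $G$ be a non-trivial group generated by a finite set $X$, let $\Sigma = X \cup X^{-1}$, and let $\pi:\Sigma^\star\to G$ be the standard projection map. If the word problem $\mathit{WP}(G,X)=\pi^{-1}(1)\subseteq\Sigma^\star$ is a visibly pushdown language, then $\mathit{WP}(G,X)$ is a regular language and $G$ is finite.
   Context: Alphabet and projection: for a finite generating set $X$ of a group $G$, $\Sigma = X\cup X^{-1}$ is the finite alphabet containing, for each $x\in X$, two distinct formal symbols $x$ and $x^{-1}$. The map $\pi:\Sigma^\star\to G$ is the monoid homomorphism sending the letters $x$ and $x^{-1}$ to the group element $x$ and its inverse, respectively. The word problem is $\mathit{WP}(G,X)=\{w\in\Sigma^\star : \pi(w)=1\}$. Visibly pushdown automaton (VPA): a pushdown automaton (finite set of states, initial state(s), set of accepting states, stack alphabet $\Gamma$ with a distinguished bottom-of-stack symbol $\bot\in\Gamma$, initial stack $\bot$) over $\Sigma$ without $\varepsilon$-transitions, for which there is a partition $\Sigma=\Sigma_c\sqcup\Sigma_i\sqcup\Sigma_r$ (calls, internals, responses; parts may be empty) such that: on reading a letter of $\Sigma_i$ the transition neither depends on nor modifies the stack; on reading a letter of $\Sigma_c$ the transition does not depend on the stack and pushes exactly one symbol, different from $\bot$; on reading a letter of $\Sigma_r$ the transition reads the topmost stack symbol and pops it, pushing nothing (if the topmost symbol is $\bot$, it is read but not removed). A word is accepted if the automaton can be in an accepting state after reading it, with no condition on the stack. (Deterministic and nondeterministic VPAs accept the same languages.) A language over $\Sigma$ is a visibly pushdown language if it is accepted by a VPA for some partition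 of $\Sigma$. *)

(* Defs.v *)
From HB Require Import structures.
From mathcomp Require Import all_boot finmap.
From mathcomp Require Import boolp classical_sets cardinality.

Set Implicit Arguments.
Unset Strict Implicit.
Unset Printing Implicit Defensive.

Local Open Scope fset_scope.
Local Open Scope classical_set_scope.

Section WordProblem.
Variables (G : groupType) (X : {fset G}).
Local Open Scope group_scope.

(* Subgroups are boolean predicates; in the presence of the axioms of [boolp]
   every subset of [G] is of this form. *)
Definition generates : Prop :=
  forall H : {pred G}, group_closed H -> {subset X <= H} -> forall g, g \in H.

(* [(x, false)] is the formal symbol x and [(x, true)] the formal symbol x^-1;
   they are distinct even if x is its own inverse, or if x^-1 is also in [X]. *)
Definition letter : finType := (X * bool)%type.

Definition letter_val (a : letter) : G :=
  if a.2 then (val a.1)^-1 else val a.1.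

Definition proj (w : seq letter) : G := \prod_(a <- w) letter_val a.

Definition word_problem : set (seq letter) := [set w | proj w = 1].

End WordProblem.

Arguments word_problem {G} X _.

Section Automata.
Variable A : finType.

Record dfa := Dfa {
  dfa_state : finType;
  dfa_init : dfa_state;
  dfa_final : {set dfa_state};
  dfa_trans : dfa_state -> A -> dfa_state }.

Definition dfa_accepts (M : dfa) (w : seq A) : Prop :=
  foldl (@dfa_trans M) (dfa_init M) w \in dfa_final M.

Definition regular (L : set (seq A)) : Prop :=
  exists M : dfa, forall w, L w <-> dfa_accepts M w.

Inductive letter_kind := Call | Internal | Response.

(* Nondeterministic automata.  Each transition map is only consulted on letters
   of its own kind (see [vpa_step]), so its values on other letters are
   irrelevant. *)
Record vpa := Vpa {
  vpa_state : finType;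
  vpa_stack : finType;
  vpa_bot : vpa_stack;
  vpa_init : {set vpa_state};
  vpa_final : {set vpa_state};
  vpa_call : vpa_state -> A -> {set vpa_state * vpa_stack};
  vpa_internal : vpa_state -> A -> {set vpa_state};
  vpa_response : vpa_state -> A -> vpa_stack -> {set vpa_state};
  vpa_call_neq_bot : forall q a p g, (p, g) \in vpa_call q a -> g != vpa_bot }.

Section Runs.
Variables (kind : A -> letter_kind) (M : vpa).

(* A state and the stack contents, topmost symbol first. *)
Definition vpa_config : Type := vpa_state M * seq (vpa_stack M).

Definition vpa_step (c : vpa_config) (a : A) (c' : vpa_config) : Prop :=
  match kind a with
  | Call =>
      exists2 g, (c'.1, g) \in vpa_call c.1 a & c'.2 = g :: c.2
  | Internal =>
      c'.1 \in vpa_internal c.1 a /\ c'.2 = c.2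
  | Response =>
      exists g s, [/\ c.2 = g :: s,
                      c'.1 \in vpa_response c.1 a g
                    & c'.2 = if g == vpa_bot M then c.2 else s]
  end.

Fixpoint vpa_run (c : vpa_config) (w : seq A) (c' : vpa_config) : Prop :=
  if w is a :: w' then exists2 c1, vpa_step c a c1 & vpa_run c1 w' c'
  else c = c'.

Definition vpa_accepts (w : seq A) : Prop :=
  exists q c, [/\ q \in vpa_init M,
                  vpa_run (q, [:: vpa_bot M]) w c
                & c.1 \in vpa_final M].

End Runs.

(* The partition of the alphabet is the family of fibres of [kind]. *)
Definition visibly_pushdown (L : set (seq A)) : Prop :=
  exists (kind : A -> letter_kind) (M : vpa),
    forall w, L w <-> vpa_accepts kind M w.

End Automata.

(* Main.v *)
(* Let c be a call letter and C its formal inverse.  Some n < m have the same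
   states reachable after C^n and after C^m; since c^m only makes calls, its
   effect on the state does not depend on the stack, so C^n c^m is accepted
   because C^m c^m is.  Hence c^N = 1 in G with N = m - n > 0.  Inserting c^N
   before every letter of a word does not change its value, but now a response
   only ever pops the call just before it, so the automaton can be simulated
   without a stack and the word problem is regular.  If there is no call letter,
   the stack never changes.  Finally, words reaching the same state of a
   deterministic automaton for the word problem have the same value, so G is
   finite. *)
Require Import Defs.
From mathcomp Require Import all_boot finmap.
From mathcomp Require Import boolp classical_sets cardinality.

Set Implicit Arguments.
Unset Strict Implicit.
Unset Printing Implicit Defensive.

Lemma finType_pigeonhole (T : finType) (f : nat -> T) :
  exists n m, n < m /\ f n = f m.
Proof.
apply: contrapT => nf.
have /leq_card : injective (fun i : 'I_#|T|.+1 => f i).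
  move=> i j eqf; apply/val_inj; case: (ltngtP i j) => // lt_ij; case: nf.
  - by exists i, j.
  - by exists j, i.
by rewrite card_ord ltnn.
Qed.

(** * Runs whose state changes do not depend on the stack *)

Section Automata.
Variables (A : finType) (kind : A -> letter_kind) (M : vpa A).
Local Notation run := (vpa_run kind).
Local Notation state := (vpa_state M).
Local Notation stack := (seq (vpa_stack M)).

Lemma vpa_run_cat (c c' : vpa_config M) u v :
  run c (u ++ v) c' <-> exists2 d, run c u d & run d v c'.
Proof.
elim: u c => [|a u IH] c /=; first by split=> [r|[d ->]//]; exists c.
split=> [[d cd /IH[e de ec']]|[e [d cd de] ec']].
  by exists e => //; exists d.
by exists d => //; apply/IH; exists e.
Qed.

(** Calls never read the stack, so the same transitions are available over [t] and push the same
    block [u]. *)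
Lemma vpa_run_calls c n (q q' : state) (s s' t : stack) : kind c = Call ->
  run (q, s) (nseq n c) (q', s') ->
  exists2 u, s' = u ++ s & run (q, t) (nseq n c) (q', u ++ t).
Proof.
move=> kc; elim: n q s t => [|n IH] q s t /=; first by case=> <- <-; exists [::].
case=> -[q1 s1]; rewrite /vpa_step kc => -[g /= qg ->] /IH-/(_ (g :: t))[u -> r].
(* Stacks list their top first, so the symbol pushed first ends the block. *)
exists (rcons u g); rewrite cat_rcons//.
by exists (q1, g :: t) => //; exists g.
Qed.

(** The only symbol that [a] can read is [g]. It differs from the bottom symbol, so a response pops
    it and never looks below. *)
Lemma vpa_step_after_call c a (q q1 q' : state) g (s s' t : stack) :
  (q1, g) \in vpa_call q c -> vpa_step kind (q1, g :: s) a (q', s') ->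
  exists t', vpa_step kind (q1, g :: t) a (q', t').
Proof.
move=> /vpa_call_neq_bot/negPf gbot; rewrite /vpa_step; case: (kind a) => /=.
- by move=> [h ? _]; exists (h :: g :: t); exists h.
- by move=> [? _]; exists (g :: t).
- move=> [_ [_ [[<- <-] ? _]]]; exists t.
  by exists g, t; rewrite gbot.
Qed.

Lemma vpa_run_calls_letter c N a (q q' : state) (s s' t : stack) :
  kind c = Call -> 0 < N -> run (q, s) (rcons (nseq N c) a) (q', s') ->
  exists t', run (q, t) (rcons (nseq N c) a) (q', t').
Proof.
case: N => // N kc _.
(* The last call is split off: its symbol is the one on top when [a] is read. *)
rewrite -[N.+1]addn1 nseqD -cats1 -catA => /vpa_run_cat[[q1 s1] r1].
move=> [[q2 s2]]; rewrite {1}/vpa_step kc => -[g /= qg ->] [d st dq'].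
rewrite {}dq' in st.
have [u _ r1'] := vpa_run_calls t kc r1.
have [t' st'] := vpa_step_after_call (u ++ t) qg st.
exists t'; apply/vpa_run_cat; exists (q1, u ++ t) => //=.
exists (q2, g :: u ++ t); first by rewrite /vpa_step kc; exists g.
by exists (q', t').
Qed.

Lemma vpa_step_no_call a (q q' : state) (s' : stack) : kind a <> Call ->
  vpa_step kind (q, [:: vpa_bot M]) a (q', s') -> s' = [:: vpa_bot M].
Proof.
rewrite /vpa_step; case: (kind a) => // _ => [[]//|].
by case=> [g [s [[<- _] _ /= ->]]]; rewrite eqxx.
Qed.

Section Oblivious.
(** [I] is an invariant of the stacks between blocks [f a]; within [I], the state changes made by a
    block are independent of the stack. It will be instantiated with all stacks if there is a call
    letter, and with the bottom stack alone otherwise. *)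
Variables (I : stack -> Prop) (f : A -> seq A).
Hypothesis I_bot : I [:: vpa_bot M].
Hypothesis f_oblivious : forall a q s q' s', I s -> run (q, s) (f a) (q', s') ->
  I s' /\ forall t, I t -> exists2 t', I t' & run (q, t) (f a) (q', t').
Local Notation subst w := (flatten [seq f a | a <- w]).

Lemma vpa_run_oblivious w q q' s s' t : I s -> I t ->
  run (q, s) (subst w) (q', s') -> exists t', run (q, t) (subst w) (q', t').
Proof.
elim: w q s t => [|a w IH] q s t Is It /=; first by case=> <- _; exists t.
case/vpa_run_cat=> -[q1 s1] /(f_oblivious Is)[Is1 /(_ t It)[t1 It1 r1]].
move=> /(IH _ _ _ Is1 It1)[t' r']; exists t'; apply/vpa_run_cat.
by exists (q1, t1).
Qed.

(** Subset construction in which every block restarts from the bottom stack. *)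
Let trans (S : {set state}) a : {set state} := finset (fun q' =>
  `[< exists2 q, q \in S & exists s, run (q, [:: vpa_bot M]) (f a) (q', s) >]).

(** Forgetting the stack after a block is harmless: that stack satisfies [I], so the rest of the run
    can be moved between it and the bottom stack. *)
Lemma foldl_transP w S q' : q' \in foldl trans S w <->
  exists2 q, q \in S & exists s, run (q, [:: vpa_bot M]) (subst w) (q', s).
Proof.
elim: w S => [|a w IH] S /=.
  split=> [qS|[q qS [s [<-]]]//].
  by exists q' => //; exists [:: vpa_bot M].
split=> [/IH[q1]|[q qS [s' /vpa_run_cat[[q1 s1] r1 r2]]]].
  rewrite inE => /asboolP[q qS [s1 r1]] [s r]; exists q => //.
  have [Is1 _] := f_oblivious I_bot r1.
  have [s' r'] := vpa_run_oblivious I_bot Is1 r.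
  by exists s'; apply/vpa_run_cat; exists (q1, s1).
apply/IH; exists q1; first by rewrite inE; apply/asboolP; exists q => //; exists s1.
have [Is1 _] := f_oblivious I_bot r1.
exact: vpa_run_oblivious Is1 I_bot r2.
Qed.

Lemma regular_oblivious : regular (fun w => vpa_accepts kind M (subst w)).
Proof.
exists (Dfa (vpa_init M)
  (finset (fun S : {set state} => [exists q in vpa_final M, q \in S])) trans).
move=> w; rewrite /dfa_accepts inE /=; split.
  case=> q [[q' s] [qi r qf]]; apply/existsP; exists q'; rewrite qf /=.
  by apply/foldl_transP; exists q => //; exists s.
case/existsP=> q' /andP[qf /foldl_transP[q qi [s r]]].
by exists q, (q', s).
Qed.

End Oblivious.
End Automata.

(** * Values of words, and the word problem *)

Section WordProblem.
Variables (G : groupType) (X : {fset G}).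
Local Open Scope group_scope.

Lemma proj_cat (u v : seq (letter X)) : proj (u ++ v) = proj u * proj v.
Proof. by rewrite /proj big_cat. Qed.

Lemma proj_rcons (u : seq (letter X)) a : proj (rcons u a) = proj u * letter_val a.
Proof. by rewrite -cats1 proj_cat /proj big_seq1. Qed.

Lemma proj_nseq n (a : letter X) : proj (nseq n a) = letter_val a ^+ n.
Proof.
elim: n => [|n IH]; first by rewrite /proj big_nil.
by rewrite expgS -IH /proj big_cons.
Qed.

Lemma proj_subst (f : letter X -> seq (letter X)) w :
  (forall a, proj (f a) = letter_val a) ->
  proj (flatten [seq f a | a <- w]) = proj w.
Proof.
move=> fE; elim: w => [//|a w IH] /=.
by rewrite proj_cat fE IH /proj big_cons.
Qed.

Definition letter_inv (a : letter X) : letter X := (a.1, ~~ a.2).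

Lemma letter_val_inv a : letter_val (letter_inv a) = (letter_val a)^-1.
Proof. by case: a => x [] //=; rewrite /letter_val /= invgK. Qed.

Lemma proj_inv (w : seq (letter X)) :
  proj (rev [seq letter_inv a | a <- w]) = (proj w)^-1.
Proof.
elim: w => [|a w IH]; first by rewrite /proj big_nil invg1.
by rewrite /= rev_cons proj_rcons IH letter_val_inv /proj big_cons invgM.
Qed.

Lemma proj_surj : generates X -> forall g, exists w : seq (letter X), proj w = g.
Proof.
move=> genX g.
pose H : {pred G} := fun h => `[< exists w : seq (letter X), proj w = h >].
suff /asboolP : g \in H by [].
apply: genX => [|x xX].
  split; first by apply/asboolP; exists [::]; rewrite /proj big_nil.
  move=> _ _ /asboolP[u <-] /asboolP[v <-]; apply/asboolP.
  (* [group_closed] asks for closure under quotients. *)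
  exists (u ++ rev [seq letter_inv a | a <- v]).
  by rewrite proj_cat proj_inv.
by apply/asboolP; exists [:: ([` xX]%fset, false)]; rewrite /proj big_seq1.
Qed.

Lemma regular_word_problem_finite :
  generates X -> regular (word_problem X) -> finite_set [set: G]%classic.
Proof.
move=> genX [M ML].
have [w wE] := choice (proj_surj genX).
pose state_of g := foldl (@dfa_trans _ M) (dfa_init M) (w g).
suff state_of_inj : injective state_of.
  rewrite -(preimage_setT state_of); apply: finite_preimage.
    by move=> g h _ _ /state_of_inj.
  exact: finite_finset.
(* From a common state, the suffix [w g^-1] leads to acceptance after [w h] as it does after
   [w g]. *)
move=> g h eq_gh; apply/esym/(mulIg g^-1); rewrite mulgV.
have /ML : word_problem X (w g ++ w g^-1).
  by rewrite /word_problem /= proj_cat !wE mulgV.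
rewrite /dfa_accepts foldl_cat -/(state_of g) eq_gh -foldl_cat => /ML.
by rewrite /word_problem /= proj_cat !wE.
Qed.

Section VisiblyPushdown.
Variables (kind : letter X -> letter_kind) (M : vpa (letter X)).
Hypothesis WP_M : forall w, word_problem X w <-> vpa_accepts kind M w.

Lemma call_letter_finite_order c : kind c = Call ->
  exists2 N, (0 < N)%N & letter_val c ^+ N = 1.
Proof.
move=> kc; pose u n := nseq n (letter_inv c).
pose reached n : {set vpa_state M} := finset (fun q => `[< exists2 q0,
  q0 \in vpa_init M & exists s, vpa_run kind (q0, [:: vpa_bot M]) (u n) (q, s) >]).
have [n [m [lt_nm eq_nm]]] := finType_pigeonhole reached.
have proj_u k l : proj (u k ++ nseq l c) = letter_val c ^- k * letter_val c ^+ l.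
  by rewrite proj_cat !proj_nseq letter_val_inv expVgn.
exists (m - n)%N; first by rewrite subn_gt0.
suff /WP_M : vpa_accepts kind M (u n ++ nseq m c).
  rewrite /word_problem /= proj_u -(subnKC (ltnW lt_nm)) expgnDr mulKg.
  by rewrite subnKC // ltnW.
have /WP_M : word_problem X (u m ++ nseq m c).
  by rewrite /word_problem /= proj_u mulVg.
case=> q0 [[q' s'] [q0i /vpa_run_cat[[q s] r0 r] qf]].
have : q \in reached m.
  by rewrite inE; apply/asboolP; exists q0 => //; exists s.
rewrite -eq_nm inE => /asboolP[q1 q1i [t r1]].
(* The calls on [c], run over the stack [s] left by [u m], are replayed over the stack [t] left by
   [u n]. *)
have [v _ r'] := vpa_run_calls t kc r.
exists q1, (q', v ++ t); split=> //.
by apply/vpa_run_cat; exists (q, t).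
Qed.

Lemma vpl_word_problem_regular : regular (word_problem X).
Proof.
have regular_subst (I : seq (vpa_stack M) -> Prop)
      (f : letter X -> seq (letter X)) : I [:: vpa_bot M] ->
    (forall a q s q' s', I s -> vpa_run kind (q, s) (f a) (q', s') ->
      I s' /\ forall t, I t ->
        exists2 t', I t' & vpa_run kind (q, t) (f a) (q', t')) ->
    (forall a, proj (f a) = letter_val a) -> regular (word_problem X).
  move=> I_bot If fE; have [D DL] := regular_oblivious I_bot If.
  by exists D => w; rewrite -DL -WP_M /word_problem /= proj_subst.
have [[c kc]|no_call] := pselect (exists c, kind c = Call).
  have [N N_gt0 cN] := call_letter_finite_order kc.
  apply: (regular_subst (fun=> True) (fun a => rcons (nseq N c) a)) => //.
    move=> a q s q' s' _ r; split=> // t _.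
    by have [t' r'] := vpa_run_calls_letter t kc N_gt0 r; exists t'.
  by move=> a; rewrite proj_rcons proj_nseq cN mul1g.
apply: (regular_subst (fun s => s = [:: vpa_bot M]) (fun a => [:: a])) => //.
  move=> a q _ q' s' -> [d st dE]; rewrite {}dE in st.
  have ka : kind a <> Call by move=> ka; apply: no_call; exists a.
  have s'E := vpa_step_no_call ka st; split=> // t ->; exists s' => //.
  by exists (q', s').
by move=> a; rewrite /proj big_seq1.
Qed.

End VisiblyPushdown.
End WordProblem.

Theorem theorem1 (G : groupType) (X : {fset G}) :
  (exists g : G, g <> 1%g) ->
  generates X ->
  visibly_pushdown (word_problem X) ->
  regular (word_problem X) /\ finite_set [set: G]%classic.
Proof.
move=> _ genX [kind [M WP_M]].
have reg := vpl_word_problem_regular WP_M.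
split; first exact: reg.
exact: regular_word_problem_finite genX reg.
Qed.
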